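(* Let $1\le p<\infty$ and let $(T_{v(s),w(s),\varphi,b})_{s\geq 1}$ be a countable family of operators of $C_+$-type on $\ell^p(\mathbb{N})$ where $b$ does not depend on $s$. Assume that there exists a constant $\alpha>0$ such that for every $s\geq 1$, every $C\geq1$ and every $k_0\geq1$, there exists an integer $k\geq k_0$ such that, for every $0\leq n\leq \alpha \Delta^{(k)}$, $$\vert v^{(k)}(s)\vert \prod_{i=n+1}^{\Delta^{(k)}-1}\vert w_{i}^{(k)}(s)\vert>C.$$ If, for any $s,t\geq 1$, there exists a constant $K_{s,t}>0$ such that for any $r\geq \rho \geq 1$, $$\left\vert\frac{w_\rho(t)w_{\rho+1}(t)\cdots w_r(t)}{w_\rho(s)w_{\rho+1}(s)\cdots w_r(s)}\right\vert\leq K_{s,t},$$ then $\bigcap_{s\geq 1}FHC(T_{v(s),w(s),\varphi,b})$ is non-empty.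
   Context: $\mathbb{N}=\{0,1,2,\ldots\}$, $(e_k)_{k\in\mathbb{N}}$ is the unit sequence of $\ell^p(\mathbb{N})$ (complex scalars). Operators of $C$-type. The data are: - $v=(v_n)_{n\geq 1}$, non-zero complex numbers with $\sum_{n\geq 1}|v_n|<\infty$; - $w=(w_n)_{n\geq 1}$, complex numbers with $0<\inf_{n\geq 1}|w_n|\leq\sup_{n\geq 1}|w_n|<\infty$; - $\varphi:\mathbb{N}\to\mathbb{N}$ with $\varphi(0)=0$, $\varphi(n)<n$ for $n\geq 1$, and $\varphi^{-1}(\{l\})$ infinite for every $l\geq 0$; - $b=(b_n)_{n\geq 0}$, a (strictly) increasing sequence of integers with $b_0=0$ and $b_{n+1}-b_n$ a multiple of $2(b_{\varphi(n)+1}-b_{\varphi(n)})$ for every $n\geq 1$. It is assumed throughout that $\inf_{n\geq 0}\prod_{b_n<j<b_{n+1}}|w_j|>0$. Empty products equal $1$. The operator of $C$-type $T_{v,w,\varphi,b}$ is the bounded operator on $\ell^p(\mathbb{N})$ determined by $$T_{v,w,\varphi,b}(e_k)=\begin{cases} w_{k+1}e_{k+1} & \text{if } k\in[b_n,b_{n+1}-1),\ n\geq 0,\\ v_ne_{b_{\varphi(n)}}-\Big(\prod_{j=b_n+1}^{b_{n+1}-1}w_j\Big)^{-1}e_{b_n} & \text{if } k=b_{n+1}-1,\ n\geq 1,\\ -\Big(\prod_{j=b_0+1}^{b_1-1}w_j\Big)^{-1}e_0 & \text{if } k=b_1-1.\end{cases}$$ Operators of $C_+$-type: operators of $C$-type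 such that for every $k\geq 1$: - $\varphi(n)=n-2^{k-1}$ for every $n\in[2^{k-1},2^k)$; - there is $\Delta^{(k)}\in\mathbb{N}$ with $b_{n+1}-b_n=\Delta^{(k)}$ for every $n\in[2^{k-1},2^k)$; - there is $v^{(k)}\in\mathbb{C}\setminus\{0\}$ with $v_n=v^{(k)}$ for every $n\in[2^{k-1},2^k)$; - there is a sequence $(w_i^{(k)})_{1\leq i<\Delta^{(k)}}$ with $w_{b_n+i}=w_i^{(k)}$ for every $1\leq i<\Delta^{(k)}$ and every $n\in[2^{k-1},2^k)$. For the family indexed by $s$, $v^{(k)}(s)$, $w_i^{(k)}(s)$ denote the quantities associated with $v(s)$, $w(s)$; since $b$ does not depend on $s$, neither does $\Delta^{(k)}$. $FHC(T)$ is the set of frequently hypercyclic vectors of $T$: those $x$ such that for every non-empty open $U$, $\underline{d}(\{n\in\mathbb{N}:T^n(x)\in U\})>0$, where $\underline{d}(E)=\liminf_{n\to\infty}\frac{\mathrm{card}([0,n]\cap E)}{n+1}$. *)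

(* Defs.v *)
From HB Require Import structures.
From mathcomp Require Import all_boot all_order all_algebra.
From mathcomp Require Import all_classical all_reals all_analysis.
From mathcomp Require Export complex.

Set Implicit Arguments.
Unset Strict Implicit.
Unset Printing Implicit Defensive.

Import Order.TTheory GRing.Theory Num.Theory.
Import numFieldNormedType.Exports.
Export Normc.

Local Open Scope classical_set_scope.
Local Open Scope ring_scope.
Local Open Scope complex_scope.

(* Moduli of complex numbers are taken in R through [normc]; the generic norm
   of [z : R[i]] is [`|z| = (normc z)%:C], with values in [R[i]]. *)

Section lp_norm.
Context {R : realType}.
Variable p : R.
Implicit Types x y : nat -> R[i].

Definition lp_norm x : \bar R :=
  Lnorm (@counting nat R) p%:E (fun n => (normc (x n))%:E).

Definition lp_pred : {pred nat -> R[i]} := [pred x | (lp_norm x < +oo)%E].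

Hypothesis p1 : 1 <= p.

Let p_gt0 : 0 < p. Proof. exact: lt_le_trans p1. Qed.

Lemma normc_ge0 (z : R[i]) : 0 <= normc z.
Proof. by case: z => a b; exact: sqrtr_ge0. Qed.

Lemma lp_normE x :
  lp_norm x = ((\sum_(k <oo) (normc (x k) `^ p)%:E) `^ p^-1)%E.
Proof.
rewrite /lp_norm Lnorm_counting//; congr (_ `^ _)%E.
by apply: eq_eseriesr => k _; rewrite gee0_abs ?lee_fin ?normc_ge0.
Qed.

Lemma lp_norm_ge0 x : (0 <= lp_norm x)%E.
Proof. exact: Lnorm_ge0. Qed.

Let sum_ge0 x : (0 <= \sum_(k <oo) (normc (x k) `^ p)%:E)%E.
Proof. by apply: nneseries_ge0 => k _ _; rewrite lee_fin powR_ge0. Qed.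

Lemma lp_normD x y : (lp_norm (x + y)%R <= lp_norm x + lp_norm y)%E.
Proof.
have mf (f : nat -> R) : measurable_fun setT f by [].
have := eminkowski (@counting nat R) (mf (fun n => normc (x n)))
  (mf (fun n => normc (y n)))
  (p1 : (1 <= p%:E)%E).
apply: le_trans; rewrite /lp_norm !Lnorm_counting//; apply: gt0_ler_poweR.
- by rewrite invr_ge0 ltW.
- by rewrite in_itv/= leey nneseries_ge0// => k _ _; exact: poweR_ge0.
- by rewrite in_itv/= leey nneseries_ge0// => k _ _; exact: poweR_ge0.
apply: lee_nneseries => k _; first by move=> _; exact: poweR_ge0.
rewrite !abse_EFin !poweR_EFin lee_fin.
apply: ge0_ler_powR; rewrite ?nnegrE ?(ltW p_gt0)//=.
by rewrite !ger0_norm ?addr_ge0 ?normc_ge0//; exact: le_normcD.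
Qed.

Lemma lp_normZ (a : R[i]) x :
  lp_norm (a *: x)%R = ((normc a)%:E * lp_norm x)%E.
Proof.
rewrite !lp_normE.
transitivity
  (((normc a `^ p)%:E * \sum_(k <oo) (normc (x k) `^ p)%:E) `^ p^-1)%E.
  rewrite -nneseriesZl; last by move=> k _; rewrite lee_fin powR_ge0.
  congr (_ `^ _)%E; apply: eq_eseriesr => k _.
  by rewrite -EFinM -powRM ?normc_ge0// -normcM.
rewrite poweRM ?lee_fin ?powR_ge0//.
by rewrite poweR_EFin -powRrM mulfV ?gt_eqF// powRr1// normc_ge0.
Qed.

Lemma lp_norm_eq0 x : lp_norm x = 0%E -> x = 0.
Proof.
rewrite lp_normE => /(poweR_eq0_eq0 (sum_ge0 x)) sum0.
apply/funext => k; apply: eq0_normc; apply: (@powR_eq0_eq0 _ _ p).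
apply/EFin_inj/eqP; rewrite eq_le; apply/andP; split; last first.
  by rewrite lee_fin powR_ge0.
rewrite -[leRHS]sum0 (@nneseriesD1 _ _ k)// ?leeDl// => [|j _]; last first.
  by rewrite lee_fin powR_ge0.
by apply: nneseries_ge0 => j _ _; rewrite lee_fin powR_ge0.
Qed.

Definition unit_seq (k : nat) : nat -> R[i] := fun j => (j == k)%:R.

Lemma lp_norm_unit_seq k : lp_norm (unit_seq k) = 1%E.
Proof.
rewrite lp_normE (@nneseriesD1 _ _ k)//; last first.
  by move=> j _; rewrite lee_fin powR_ge0.
rewrite eseries0 => [|j _ /negPf jk].
  by rewrite adde0 /unit_seq eqxx normc1 powR1 poweR1r.
by rewrite /unit_seq jk normc0 powR0 ?gt_eqF.
Qed.

Lemma lp_submod_closed : submod_closed lp_pred.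
Proof.
split=> [|a x y].
  by rewrite inE -(scale0r 0) lp_normZ normc0 mul0e ltry.
rewrite !inE => xoo yoo; apply: (le_lt_trans (lp_normD _ _)).
by rewrite lte_add_pinfty// lp_normZ lte_mul_pinfty ?lee_fin ?normc_ge0.
Qed.

Lemma unit_seq_lp k : unit_seq k \in lp_pred.
Proof. by rewrite inE lp_norm_unit_seq ltry. Qed.

End lp_norm.

(* As for [LfunType], the type carries the proof of [1 <= p], which the
   normed structure depends on. *)
Record lp (R : realType) (p : R) (p1 : 1 <= p) := Lp {
  lp_val :> nat -> R[i];
  lp_valP : lp_val \in lp_pred p }.

Section lp_normed.
Context (R : realType) (p : R) (p1 : 1 <= p).

HB.instance Definition _ :=
  GRing.isSubmodClosed.Build _ _ (lp_pred p) (lp_submod_closed p1).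
HB.instance Definition _ := [isSub of lp p1 for @lp_val R p p1].
HB.instance Definition _ := [Choice of lp p1 by <:].
HB.instance Definition _ := [SubChoice_isSubLmodule of lp p1 by <:].

Definition lp_normr (x : lp p1) : R[i] := (fine (lp_norm p x))%:C.

Lemma lp_norm_fin_num (x : lp p1) : lp_norm p x \is a fin_num.
Proof. by rewrite ge0_fin_numE ?lp_norm_ge0//; have := lp_valP x; rewrite inE. Qed.

Lemma lp_normrD (x y : lp p1) : lp_normr (x + y) <= lp_normr x + lp_normr y.
Proof.
rewrite -rmorphD/= lecR -fineD ?lp_norm_fin_num// fine_le ?lp_norm_fin_num//.
  by rewrite fin_numD !lp_norm_fin_num.
exact: lp_normD.
Qed.

Lemma lp_normrZ (a : R[i]) (x : lp p1) : lp_normr (a *: x) = `|a| * lp_normr x.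
Proof.
rewrite /lp_normr [X in fine X](lp_normZ p1 a x) fineM ?lp_norm_fin_num//.
by rewrite rmorphM.
Qed.

Lemma lp_normr_eq0 (x : lp p1) : lp_normr x = 0 -> x = 0.
Proof.
case=> x0; apply/val_inj/(lp_norm_eq0 p1).
by rewrite -(fineK (lp_norm_fin_num x)) x0.
Qed.

HB.instance Definition _ := Lmodule_isNormed.Build R[i] (lp p1)
  lp_normrD lp_normrZ lp_normr_eq0.

Definition lp_unit (k : nat) : lp p1 := Lp p1 (unit_seq_lp p1 k).

End lp_normed.

(* Sequences indexed by [n >= 1] are total functions whose value at 0 is never
   used. *)
Record C_type_data (R : realType) (v w : nat -> R[i]) (phi b : nat -> nat) :
    Prop := CTypeData {
  C_type_v_neq0 : forall n, (1 <= n)%N -> v n != 0;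
  C_type_v_summable : (\sum_(1 <= n <oo) (normc (v n))%:E < +oo)%E;
  C_type_w_inf :
    (0 < ereal_inf [set (normc (w n))%:E | n in [set n | (1 <= n)%N]])%E;
  C_type_w_sup :
    (ereal_sup [set (normc (w n))%:E | n in [set n | (1 <= n)%N]] < +oo)%E;
  C_type_phi0 : phi 0%N = 0%N;
  C_type_phi_lt : forall n, (1 <= n)%N -> (phi n < n)%N;
  C_type_phi_fiber : forall l, infinite_set (phi @^-1` [set l]);
  C_type_b0 : b 0%N = 0%N;
  C_type_b_incr : {homo b : m n / (m < n)%N};
  C_type_b_dvd : forall n, (1 <= n)%N ->
    (2 * (b (phi n).+1 - b (phi n)) %| b n.+1 - b n)%N;
  C_type_w_prod_inf : (0 < ereal_inf
    (range (fun n => (\prod_((b n).+1 <= j < b n.+1) normc (w j))%:E)))%E }.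

(* The bounded operator is characterised by its values on the unit sequence,
   whose linear span is dense in [lp p1] since [p] is finite. *)
Record is_C_type_operator (R : realType) (p : R) (p1 : 1 <= p)
    (v w : nat -> R[i]) (phi b : nat -> nat) (T : {linear lp p1 -> lp p1}) :
    Prop := IsCTypeOperator {
  C_type_bounded : continuous T;
  C_type_shift : forall n k, (b n <= k < (b n.+1).-1)%N ->
    T (lp_unit p1 k) = w k.+1 *: lp_unit p1 k.+1;
  C_type_last : forall n, (1 <= n)%N ->
    T (lp_unit p1 (b n.+1).-1) =
      v n *: lp_unit p1 (b (phi n))
      - (\prod_((b n).+1 <= j < b n.+1) w j)^-1 *: lp_unit p1 (b n);
  C_type_last0 :
    T (lp_unit p1 (b 1%N).-1) =
      - ((\prod_((b 0%N).+1 <= j < b 1%N) w j)^-1 *: lp_unit p1 0%N) }.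

(* [Delta k], [vk k] and [wk k i] stand for $\Delta^{(k)}$, $v^{(k)}$ and
   $w_i^{(k)}$. *)
Record C_plus_type_data (R : realType) (v w : nat -> R[i]) (phi b : nat -> nat)
    (Delta : nat -> nat) (vk : nat -> R[i]) (wk : nat -> nat -> R[i]) :
    Prop := CPlusTypeData {
  C_plus_C_type : C_type_data v w phi b;
  C_plus_phi : forall k n, (1 <= k)%N -> (2 ^ k.-1 <= n < 2 ^ k)%N ->
    phi n = (n - 2 ^ k.-1)%N;
  C_plus_b : forall k n, (1 <= k)%N -> (2 ^ k.-1 <= n < 2 ^ k)%N ->
    (b n.+1 - b n)%N = Delta k;
  C_plus_vk_neq0 : forall k, (1 <= k)%N -> vk k != 0;
  C_plus_v : forall k n, (1 <= k)%N -> (2 ^ k.-1 <= n < 2 ^ k)%N ->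
    v n = vk k;
  C_plus_w : forall k n i, (1 <= k)%N -> (2 ^ k.-1 <= n < 2 ^ k)%N ->
    (1 <= i < Delta k)%N -> w (b n + i)%N = wk k i }.

Definition lower_density (R : realType) (E : set nat) : \bar R :=
  limn_einf (fun n =>
    (#|[pred k : 'I_n.+1 | (k : nat) \in E]|%:R / n.+1%:R)%:E).

Definition FHC (R : realType) (X : topologicalType) (T : X -> X) : set X :=
  [set x | forall U : set X, open U -> U !=set0 ->
    (0 < lower_density R [set n | U (iter n T x)])%E].

(* Main.v *)
Require Import Defs.
From mathcomp Require Import all_boot all_order all_algebra.
From mathcomp Require Import all_classical all_reals all_analysis.
From mathcomp Require Import ring lra zify.

Set Implicit Arguments.
Unset Strict Implicit.
Unset Printing Implicit Defensive.

Import Order.TTheory GRing.Theory Num.Theory.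
Import numFieldNormedType.Exports.

Local Open Scope classical_set_scope.
Local Open Scope ring_scope.

(** In the [n]-th block, [n >= 1], let [f_m] be the vector [e_(b n + m)] divided by
[v n * w_(b n + m + 1) * ... * w_(b (n+1) - 1)], and let [L] be the length of the
block.  The operator maps [f_m] to [f_(m+1)] inside the block, and the last one to
[e_(b (phi n)) - f_0]; therefore
<<
  T^m f_r = f_(r+m)   and   T^(L-r+j) f_r = T^j e_(b (phi n)) - f_j.
>>
At a level [k] supplied by the growth hypothesis the vectors [f_m] are as small as
desired for [m <= alpha * Delta k], and every small index is [phi n] for some [n]
of that level.  So each finitely supported [u] admits a small, finitely supported
[z] with [T^(Delta k + j) z] close to [T^j u] for all [j] up to a fixed fraction of
[Delta k].  The bounds on the quotients of weights make the orbit of this same [z]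
small, up to a fixed fraction of [Delta k], under every operator of the family,
whether or not [k] is a good level for that operator.

Finitely supported vectors are periodic, with periods depending on [b] only.  If
[y] lives below level [k] then [Delta k] is a period of [y]; with [u := a - y] the
vector [y + z] has period [2 * Delta k] and [T^(Delta k + j) (y + z)] is close to
[T^j a] for [j] up to a fixed fraction of [Delta k]: the orbit of [y + z] passes
near the periodic vector [a] at a positive proportion of times
([C_plus_stage]).

The common frequently hypercyclic vector is a series of such blocks [z].  Each
stage serves a single task, an operator together with a target [a] from a
countable dense set.  At a stage serving another task, the returns of the current
partial sum near [a] survive during a fixed fraction of the new period, so that
their density is divided by a constant ([hits_step]).  Tasks are ordered by the
2-adic valuation, so each of them recurs with bounded gaps, and the total loss of
density between two services of the same task stays bounded
([nested_returns_density]). *)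

(** * The norm of the sequence space *)

Section lp_geometry.
Context (R : realType) (p : R) (p1 : 1 <= p).
Implicit Types x y : lp p1.

Definition lpn x : R := fine (lp_norm p x).

Lemma lp_normEn x : lp_norm p x = (lpn x)%:E.
Proof. by rewrite /lpn fineK// lp_norm_fin_num. Qed.

Lemma lpn_ge0 x : 0 <= lpn x.
Proof. by rewrite -lee_fin -lp_normEn lp_norm_ge0. Qed.

Lemma ler_lpnD x y : lpn (x + y) <= lpn x + lpn y.
Proof. by rewrite -lee_fin EFinD -!lp_normEn lp_normD. Qed.

Lemma lpnZ (a : R[i]) x : lpn (a *: x) = normc a * lpn x.
Proof. by apply: EFin_inj; rewrite EFinM -!lp_normEn [LHS](lp_normZ p1). Qed.

Lemma lpn_unit k : lpn (lp_unit p1 k) = 1.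
Proof. by apply: EFin_inj; rewrite -lp_normEn lp_norm_unit_seq. Qed.

Lemma lpn0 : lpn 0 = 0.
Proof. by rewrite -(scale0r (0 : lp p1)) lpnZ normc0 mul0r. Qed.

Lemma lpnN x : lpn (- x) = lpn x.
Proof. by rewrite -scaleN1r lpnZ normcN normc1 mul1r. Qed.

Lemma lpnBC x y : lpn (x - y) = lpn (y - x).
Proof. by rewrite -lpnN opprB. Qed.

Lemma ler_lpn_dist z x y : lpn (x - y) <= lpn (x - z) + lpn (z - y).
Proof. by apply: le_trans (ler_lpnD _ _); rewrite addrA subrK. Qed.

Lemma ler_lpn_sum (I : Type) (r : seq I) (P : pred I) (F : I -> lp p1) :
  lpn (\sum_(i <- r | P i) F i) <= \sum_(i <- r | P i) lpn (F i).
Proof.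
elim/big_ind2: _ => [|x a y c xa yc|//]; first by rewrite lpn0.
by apply: le_trans (ler_lpnD _ _) _; apply: lerD.
Qed.

Lemma norm_lpn x : `|x| = (lpn x)%:C%C.
Proof. by []. Qed.

Lemma lp_coordD x y i : (x + y : lp p1) i = x i + y i.
Proof. by []. Qed.

Lemma lp_coordZ (a : R[i]) x i : (a *: x : lp p1) i = a * x i.
Proof. by []. Qed.

Lemma lp_coordN x i : (- x : lp p1) i = - x i.
Proof. by []. Qed.

Lemma lp_coord_sum (I : Type) (r : seq I) (P : pred I) (F : I -> lp p1) i :
  (\sum_(j <- r | P j) F j : lp p1) i = \sum_(j <- r | P j) F j i.
Proof. by elim/big_ind2: _ => [//|x a y c <- <-//|//]. Qed.

Lemma lp_coord_unit k i : lp_unit p1 k i = (i == k)%:R.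
Proof. by []. Qed.

Lemma lpP x y : (forall i, x i = y i) -> x = y.
Proof. by move=> xy; apply/val_inj/funext. Qed.

Lemma nneseries_leP (u : nat -> R) (M : \bar R) : (forall i, 0 <= u i) ->
  (forall n, (\sum_(0 <= i < n) u i)%:E <= M)%E ->
  (\sum_(0 <= i <oo) (u i)%:E <= M)%E.
Proof.
move=> u0 uM; apply: lime_le.
  by apply: is_cvg_nneseries => i _ _; rewrite lee_fin.
by apply: nearW => n; rewrite sumEFin.
Qed.

(** The [p]-sum is the supremum of its finite sections, each of which is a section
of the [p]-sum of some [y]. *)
Lemma lp_norm_le_sections (u : nat -> R[i]) (M : R) : 0 <= M ->
  (forall n, exists2 y : lp p1, forall i, (i < n)%N -> y i = u i & lpn y <= M) ->
  (lp_norm p u <= M%:E)%E.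
Proof.
move=> M0 uM; rewrite lp_normE//.
have p0 : 0 < p by exact: lt_le_trans p1.
have -> : M%:E = (((M `^ p)%:E) `^ p^-1)%E.
  by rewrite poweR_EFin -powRrM mulfV ?gt_eqF// powRr1.
apply: gt0_ler_poweR; rewrite ?invr_ge0 ?(ltW p0)//.
- by rewrite in_itv/= leey nneseries_ge0// => k _ _; rewrite lee_fin powR_ge0.
- by rewrite in_itv/= leey lee_fin powR_ge0.
apply: nneseries_leP => [i|n]; first exact: powR_ge0.
have [y yu yM] := uM n.
rewrite (_ : (\sum_(0 <= i < n) _)%:E = \sum_(0 <= i < n) (normc (y i) `^ p)%:E)%E;
    last first.
  by rewrite sumEFin; congr EFin; apply: eq_big_nat => i /andP[_ /yu ->].
apply: (@le_trans _ _ (\sum_(0 <= k <oo) (normc (y k) `^ p)%:E)%E).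
  by apply: nneseries_lim_ge => k _ _; rewrite lee_fin powR_ge0.
have -> : (\sum_(0 <= k <oo) (normc (y k) `^ p)%:E = (lpn y `^ p)%:E)%E.
  have s0 : (0 <= \sum_(0 <= k <oo) (normc (y k) `^ p)%:E)%E.
    by apply: nneseries_ge0 => k _ _; rewrite lee_fin powR_ge0.
  rewrite -poweR_EFin -lp_normEn lp_normE// -poweRrM mulVf ?gt_eqF// poweRe1//.
by rewrite lee_fin ge0_ler_powR ?nnegrE ?lpn_ge0 ?(ltW p0).
Qed.

Lemma lpn_le_sections x (M : R) : 0 <= M ->
  (forall n, exists2 y : lp p1, forall i, (i < n)%N -> y i = x i & lpn y <= M) ->
  lpn x <= M.
Proof. by move=> M0 xM; rewrite -lee_fin -lp_normEn; exact: lp_norm_le_sections. Qed.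

Definition supp_lt (n : nat) x := forall i, (n <= i)%N -> x i = 0.

Lemma supp_ltW m n x : (m <= n)%N -> supp_lt m x -> supp_lt n x.
Proof. by move=> mn xm i ni; apply: xm; exact: leq_trans ni. Qed.

Lemma supp_ltD n x y : supp_lt n x -> supp_lt n y -> supp_lt n (x + y).
Proof. by move=> xn yn i ni; rewrite lp_coordD xn// yn// addr0. Qed.

Lemma supp_ltB n x y : supp_lt n x -> supp_lt n y -> supp_lt n (x - y).
Proof. by move=> xn yn i ni; rewrite lp_coordD lp_coordN xn// yn// subr0. Qed.

Definition truncation (u : nat -> R[i]) n : lp p1 :=
  \sum_(h < n) u h *: lp_unit p1 h.

Lemma truncationE u n i : truncation u n i = if (i < n)%N then u i else 0.
Proof.
rewrite lp_coord_sum; under eq_bigr do rewrite lp_coordZ lp_coord_unit.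
case: ltnP => ni; last first.
  by rewrite big1// => h _; rewrite gtn_eqF ?mulr0//; exact: leq_trans ni.
rewrite (bigD1 (Ordinal ni))//= eqxx mulr1 big1 ?addr0// => h hi.
suff -> : (i == h) = false by rewrite mulr0.
by apply: contraNF hi => /eqP ih; apply/eqP/val_inj.
Qed.

Lemma supp_lt_sum n x : supp_lt n x -> x = \sum_(h < n) x h *: lp_unit p1 h.
Proof.
move=> xn; apply: lpP => i; rewrite -/(truncation x n) truncationE.
by case: ltnP => // /xn.
Qed.

(** The norm of [x - truncation x n] is governed by the tail of a convergent
series; this is where [p] finite matters. *)
Lemma truncation_cvg x (e : R) : 0 < e -> exists n, lpn (x - truncation x n) < e.
Proof.
move=> e0; have p0 : 0 < p by exact: lt_le_trans p1.
pose f k := (normc (x k) `^ p)%:E.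
have f0 k : (0 <= f k)%E by rewrite lee_fin powR_ge0.
have foo : (\sum_(0 <= k <oo) f k < +oo)%E.
  have := lp_valP x; rewrite inE lp_normE//; apply: lty_poweRy.
  by rewrite invr_neq0 ?gt_eqF.
have /fine_cvgP[_] := nneseries_tail_cvg foo (fun k _ => f0 k).
have ep0 : 0 < (e / 2) `^ p by rewrite powR_gt0 ?divr_gt0.
move=> /cvgrPdist_lt /(_ _ ep0) [n _ /(_ n (leqnn n))]/=.
rewrite sub0r normrN => ne; exists n.
have e2 : e / 2 < e by rewrite gtr_pMr// invf_lt1// ltr1n.
apply: le_lt_trans e2; rewrite -lee_fin -lp_normEn lp_normE//.
have -> : (e / 2)%:E = ((((e / 2) `^ p)%:E) `^ p^-1)%E.
  by rewrite poweR_EFin -powRrM mulfV ?gt_eqF// powRr1// divr_ge0 ?ltW.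
apply: gt0_ler_poweR; rewrite ?invr_ge0 ?(ltW p0)//.
- by rewrite in_itv/= leey nneseries_ge0// => k _ _; rewrite lee_fin powR_ge0.
- by rewrite in_itv/= leey lee_fin powR_ge0.
have tfin : (\sum_(n <= k <oo) f k)%E \is a fin_num.
  rewrite ge0_fin_numE ?nneseries_ge0//; apply: le_lt_trans foo.
  rewrite (@nneseries_split _ f 0 n)//.
  by rewrite leeDr// sume_ge0.
apply: (@le_trans _ _ (\sum_(n <= k <oo) f k)%E); last first.
  by rewrite -(fineK tfin) lee_fin ltW// (le_lt_trans (ler_norm _))// ltW.
rewrite [leRHS]eseries_cond [leRHS]eseries_mkcond.
apply: lee_nneseries => [k _ _|k _]; first by rewrite lee_fin powR_ge0.
rewrite andTb lp_coordD lp_coordN truncationE.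
case: leqP => _; first by rewrite subr0.
by rewrite subrr normc0 powR0// gt_eqF.
Qed.

(** Successive blocks start further and further out, so each coordinate of the sum is
a finite sum, and [lp_norm_le_sections] transfers the norm bounds of the partial
sums to the limit. *)
Lemma lp_block_series (z : nat -> lp p1) :
  (forall j i, (i < j)%N -> z j i = 0) ->
  (forall j, lpn (z j) <= 2^-1 ^+ j) ->
  exists x, forall J, lpn (x - \sum_(j < J) z j) <= 2 * 2^-1 ^+ J.
Proof.
move=> z0 zle.
pose y J := \sum_(j < J) z j.
have yE J i : (i < J)%N -> y J i = y i.+1 i.
  elim: J => // J IH; rewrite ltnS leq_eqVlt => /predU1P[->//|iJ].
  by rewrite {1}/y big_ord_recr lp_coordD [X in X + _]IH// z0// addr0.
have yB J n : lpn (y (J + n)%N - y J) <= 2 * 2^-1 ^+ J - 2 * 2^-1 ^+ (J + n).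
  elim: n => [|n IH]; first by rewrite addn0 !subrr lpn0.
  rewrite addnS {1}/y big_ord_recr/= addrAC.
  apply: le_trans (ler_lpnD _ _) _.
  apply: le_trans (lerD IH (zle _)) _.
  rewrite exprS mulrA divff ?mul1r ?pnatr_eq0//.
  by rewrite le_eqVlt; apply/orP; left; apply/eqP; ring.
have h0 J : 0 <= 2 * 2^-1 ^+ J :> R by rewrite mulr_ge0 ?exprn_ge0 ?invr_ge0.
have yB' J n : lpn (y (J + n)%N - y J) <= 2 * 2^-1 ^+ J.
  by apply: le_trans (yB J n) _; rewrite lerBlDr lerDl h0.
have xlp : (fun i => y i.+1 i) \in lp_pred p.
  rewrite inE; apply: le_lt_trans (ltry 2); apply: lp_norm_le_sections => // n.
  exists (y n); first by move=> i /yE.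
  by have := yB' 0%N n; rewrite /y big_ord0 subr0 expr0 mulr1.
exists (Lp p1 xlp) => J; apply: lpn_le_sections => // n.
exists (y (J + n)%N - y J) => // i ni.
by rewrite !lp_coordD !lp_coordN/= yE// (leq_trans ni)// leq_addl.
Qed.

Definition rat_lp (s : seq (rat * rat)) : lp p1 :=
  truncation (fun i => (ratr (nth 0 s i).1 +i* ratr (nth 0 s i).2)%C) (size s).

Lemma normc_le_ReIm (a c : R) : normc (a +i* c)%C <= `|a| + `|c|.
Proof.
have -> : (a +i* c)%C = (a +i* 0)%C + (0 +i* c)%C.
  by rewrite /GRing.add/= addr0 add0r.
apply: le_trans (le_normcD _ _) _.
by rewrite /normc/= expr0n/= addr0 add0r !sqrtr_sqr.
Qed.

Lemma rat_complex_approx (a : R[i]) (e : R) : 0 < e ->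
  exists q : rat * rat, normc (a - (ratr q.1 +i* ratr q.2)%C) < e.
Proof.
move=> e0; have e2 : 0 < e / 2 by rewrite divr_gt0.
have ap (c : R) : exists q : rat, `|c - ratr q| < e / 2.
  have /rat_in_itvoo[q] : c - e / 2 < c + e / 2.
    by rewrite ltrBlDr -addrA ltrDl addr_gt0.
  by rewrite in_itv/= -ltr_distlC => qc; exists q.
case: a => a1 a2; have [q1 h1] := ap a1; have [q2 h2] := ap a2.
exists (q1, q2); apply: le_lt_trans (normc_le_ReIm _ _) _ => /=.
by rewrite [e]splitr ltrD.
Qed.

Lemma rat_lp_dense x (e : R) : 0 < e -> exists s, lpn (x - rat_lp s) < e.
Proof.
move=> e0; have e2 : 0 < e / 2 by rewrite divr_gt0.
have [n xn] := truncation_cvg x e2.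
have en : 0 < e / 2 / n.+1%:R by rewrite divr_gt0// ltr0n.
have [q qE] := choice (fun i => rat_complex_approx (x i) en).
exists (mkseq q n); apply: le_lt_trans (ler_lpn_dist (truncation x n) _ _) _.
rewrite [ltRHS]splitr; apply: ltr_leD => //.
rewrite /rat_lp size_mkseq /truncation -sumrB.
apply: le_trans (ler_lpn_sum _ _ _) _.
apply: (@le_trans _ _ (\sum_(i < n) e / 2 / n.+1%:R)).
  apply: ler_sum => i _; rewrite -scalerBl lpnZ lpn_unit mulr1 nth_mkseq//.
  exact/ltW/qE.
rewrite sumr_const card_ord -[X in X <= _]mulr_natr mulrAC ler_pdivrMr ?ltr0n//.
apply: ler_wpM2l; first exact: ltW.
by rewrite ler_nat.
Qed.

Lemma rat_lp_supp s : supp_lt (size s) (rat_lp s).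
Proof. by move=> i si; rewrite truncationE ltnNge si. Qed.

Lemma continuous_lpn_bound (T : {linear lp p1 -> lp p1}) : continuous T ->
  exists2 M : R, 0 <= M & forall x, lpn (T x) <= M * lpn x.
Proof.
move=> /linear_bounded_continuous/linear_boundedP/pinfty_ex_gt0[M M0 TM].
have Mr : M = (complex.Re M)%:C%C.
  by case: M M0 {TM} => a c; rewrite ltcE/= => /andP[/eqP->].
exists (complex.Re M); first by move: M0; rewrite Mr ltcR => /ltW.
by move=> x; have := TM x; rewrite !norm_lpn Mr -rmorphM/= lecR.
Qed.

Lemma open_lpn_ball (U : set (lp p1)) x : open U -> U x ->
  exists2 e : R, 0 < e & forall y, lpn (y - x) < e -> U y.
Proof.
move=> oU Ux; have /nbhs_ballP[e /= e0 eU] := open_nbhs_nbhs (conj oU Ux).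
have er : e = (complex.Re e)%:C%C.
  by case: e e0 {eU} => a c; rewrite ltcE/= => /andP[/eqP->].
exists (complex.Re e); first by move: e0; rewrite er ltcR.
by move=> y yx; apply: eU; rewrite -ball_normE /ball_/= norm_lpn lpnBC er ltcR.
Qed.

End lp_geometry.

(** * Counting returns *)

Definition hits (P : pred nat) n := count P (iota 0 n).

Lemma leq_hits (P Q : pred nat) m n : (m <= n)%N ->
  (forall i, (i < m)%N -> P i -> Q i) -> (hits P m <= hits Q n)%N.
Proof.
move=> mn PQ; rewrite /hits -(subnKC mn) iotaD count_cat.
apply: leq_trans (leq_addr _ _); rewrite -2!size_filter.
rewrite (@eq_in_filter _ P (fun i => P i && Q i)); last first.
  move=> i; rewrite mem_iota add0n => /andP[_ im]; apply/idP/andP => [Pi|[]//].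
  by split=> //; exact: PQ.
by rewrite !size_filter sub_count// => i /andP[].
Qed.

Lemma hits_periodic (P : pred nat) d k : (forall i, P i -> P (i + d)%N) ->
  (k * hits P d <= hits P (k * d))%N.
Proof.
move=> Pd; elim: k => [|k IH]; first by rewrite mul0n.
rewrite mulSnr /hits [in X in (_ <= X)%N]mulSnr iotaD count_cat leq_add//.
rewrite add0n -{1}[(k * d)%N]addn0 iotaDl count_map.
apply: sub_count => i Pi /=.
by elim: (k) => [|k' IH']; rewrite ?mul0n// mulSn -addnA addnC; apply: Pd.
Qed.

(** A window [n] at least as long as the period contains whole periods covering at
least half of it, hence the factor 2. *)
Lemma hits_extend (P : pred nat) d c n : (0 < d <= n)%N ->
  (forall i, P i -> P (i + d)%N) -> (d <= c * hits P d)%N ->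
  (n <= 2 * c * hits P n)%N.
Proof.
move=> /andP[d0 dn] Pd dc.
have kdn : (n %/ d * d <= n)%N := leq_trunc_div n d.
have h1 : (hits P (n %/ d * d) <= hits P n)%N by exact: leq_hits.
have h2 := leq_trans (hits_periodic (n %/ d) Pd) h1.
have k0 : (0 < n %/ d)%N by rewrite divn_gt0.
apply: (@leq_trans (2 * (n %/ d * d))).
  by have := ltn_ceil n d0; move: (n %/ d)%N k0 => k; nia.
rewrite -mulnA leq_mul2l /=; apply: leq_trans (leq_mul (leqnn c) h2).
by rewrite mulnCA leq_mul2l dc orbT.
Qed.

(** The abstract setting of the density estimate.  [G j i] stands for: at time [i] the
orbit of the partial sum built up to stage [j] is near the target.  It has period
[2 * D j], and during the first [D j.+1 / B] steps the next block does not disturb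
it.  [E] is the set of return times of the limit vector, and [good] singles out the
stages that serve the target, which is itself periodic of period [q]. *)
Section nested_returns.
Variables (D : nat -> nat) (B : nat) (B0 : (0 < B)%N).
Hypothesis D0 : forall j, (0 < D j)%N.
Hypothesis Dgrow : forall j, (4 * B * D j <= D j.+1)%N.
Variable G : nat -> pred nat.
Hypothesis Gper : forall j i, G j i -> G j (i + 2 * D j)%N.
Hypothesis Gnext : forall j i, (B * i <= D j.+1)%N -> G j i -> G j.+1 i.

Lemma div_window j :
  (2 * D j <= D j.+1 %/ B)%N /\ (D j.+1 <= 2 * B * (D j.+1 %/ B))%N.
Proof.
have h : (2 * D j <= D j.+1 %/ B)%N.
  by rewrite leq_divRL//; have := Dgrow j; nia.
split=> //; have := ltn_ceil (D j.+1) B0; have := D0 j.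
move: (D j.+1 %/ B)%N h => x h Dj; rewrite mulSn => lt_D.
have : (B <= x * B)%N by rewrite leq_pmull//; lia.
by move: lt_D; rewrite -mulnA [(B * x)%N]mulnC; lia.
Qed.

Lemma window_lt j i : (i < D j.+1 %/ B)%N -> (B * i <= D j.+1)%N.
Proof. by rewrite leq_divRL// mulSn mulnC; lia. Qed.

(** At least half of the window [D j.+1 / B] consists of whole periods of [G j], and the window
is at least [1 / (4 * B)] of the new period [2 * D j.+1]. *)
Lemma hits_step j c : (2 * D j <= c * hits (G j) (2 * D j))%N ->
  (2 * D j.+1 <= 8 * B * c * hits (G j.+1) (2 * D j.+1))%N.
Proof.
move=> jc; have [w1 w2] := div_window j.
have := @hits_extend (G j) (2 * D j) c (D j.+1 %/ B) _ (@Gper j) jc.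
have le : (D j.+1 %/ B <= 2 * D j.+1)%N by apply: leq_trans (leq_div _ _) _; lia.
have := leq_hits le (fun i ib => Gnext (window_lt ib)).
have := D0 j; move: w1 w2 {le}.
move: (D j.+1 %/ B)%N (hits _ _) (hits _ _) => x a' a w1 w2 D1 aa' h.
have {}h : (x <= 2 * c * a')%N.
  by apply: leq_trans (h _) _; [lia|rewrite leq_mul2l aa' orbT].
apply: (@leq_trans (4 * B * x)); first by nia.
apply: (@leq_trans (4 * B * (2 * c * a'))); last by nia.
by rewrite leq_mul2l h orbT.
Qed.

Lemma hits_iter j k c : (2 * D j <= c * hits (G j) (2 * D j))%N ->
  (2 * D (j + k) <= (8 * B) ^ k * c * hits (G (j + k)) (2 * D (j + k)))%N.
Proof.
move=> jc; elim: k => [|k IH]; first by rewrite addn0 expn0 mul1n.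
by rewrite addnS expnS -(mulnA (8 * B)%N); apply: hits_step.
Qed.

Variables (E : pred nat) (q M : nat) (good : pred nat).
Hypothesis q0 : (0 < q)%N.
Hypothesis GE : forall j i, (B * i <= D j.+1)%N -> G j i -> E i.
Hypothesis Ggood : forall j i, good j -> (B * (q * i) <= D j)%N -> G j (D j + q * i)%N.
Variable j0 : nat.
Hypothesis goodM : forall k, (j0 <= k)%N -> exists2 j, (k <= j <= k + M)%N & good j.
Hypothesis B1 : (1 < B)%N.

Lemma hits_good j : good j -> (2 * D j <= 2 * B * q * hits (G j) (2 * D j))%N.
Proof.
move=> gj; pose r := (D j %/ (B * q)).+1.
have Bq0 : (0 < B * q)%N by rewrite muln_gt0 B0.
have rD : (D j < r * (B * q))%N by exact: ltn_ceil.
have rD' : ((r.-1) * (B * q) <= D j)%N by exact: leq_trunc_div.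
suff : (r <= hits (G j) (2 * D j))%N.
  move=> ?; apply: (@leq_trans (2 * (B * q) * r)); first lia.
  by rewrite -!mulnA !leq_mul2l; lia.
pose s := [seq (D j + q * i)%N | i <- iota 0 r].
have -> : r = size s by rewrite size_map size_iota.
rewrite /hits -size_filter; apply: uniq_leq_size.
  rewrite map_inj_uniq ?iota_uniq// => a c; nia.
move=> i /mapP[a]; rewrite mem_iota add0n => /andP[_ ar] ->.
have aD : (B * (q * a) <= D j)%N.
  by apply: leq_trans rD'; rewrite mulnA mulnC leq_mul2r; apply/orP; right; lia.
rewrite mem_filter mem_iota Ggood//= add0n.
have := D0 j; nia.
Qed.

Lemma D_cofinal k n : (2 * D k <= n)%N ->
  exists2 j, (k <= j)%N & (2 * D j <= n < 2 * D j.+1)%N.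
Proof.
have Dlt j : (D j < D j.+1)%N by have := Dgrow j; have := D0 j; nia.
have Dj j : (j <= D j)%N.
  by elim: j => // j IH; apply: leq_ltn_trans IH (Dlt j).
move=> kn; have ex : exists j, (2 * D j <= n)%N by exists k.
have ub j : (2 * D j <= n)%N -> (j <= n)%N by have := Dj j; lia.
case: (ex_maxnP ex ub) => j jn jmax; exists j; first exact: jmax.
by rewrite jn ltnNge; apply/negP => /jmax; rewrite ltnn.
Qed.

(** A good stage starts with density [1 / (2 * B * q)], every later stage divides it by
at most [8 * B], and a good stage recurs within [M] steps: the density of [G j] is
bounded below uniformly in [j].  A time [n] between two consecutive periods
[2 * D j] and [2 * D j.+1] is compared with the part of [0, n) on which [E] contains
[G j], which is at least a fraction [1 / (4 * B)] of it. *)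
Lemma nested_returns_density :
  exists c n0, forall n, (n0 <= n)%N -> (n <= c * hits E n)%N.
Proof.
pose C := ((8 * B) ^ M * (2 * B * q))%N.
have jC j : (j0 + M <= j)%N -> (2 * D j <= C * hits (G j) (2 * D j))%N.
  move=> jM; have [|i /andP[i1 i2] gi] := goodM (k := (j - M)%N); first lia.
  have := hits_iter (j - i) (hits_good gi).
  rewrite subnKC; last lia.
  move=> /leq_trans; apply; rewrite leq_mul2r; apply/orP; right.
  by rewrite leq_mul2r; apply/orP; right; rewrite leq_pexp2l//; lia.
exists (8 * B * C)%N, (2 * D (j0 + M))%N => n /D_cofinal[j jM /andP[jn nj]].
have [w1 w2] := div_window j.
pose n' := minn n (D j.+1 %/ B).
have n'n : (2 * D j <= n')%N by rewrite leq_min jn.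
have h1 := @hits_extend (G j) (2 * D j) C n' _ (@Gper j) (jC _ jM).
have {}h1 := h1 ltac:(have := D0 j; lia).
have h2 : (hits (G j) n' <= hits E n)%N.
  apply: leq_hits => [|i]; first by rewrite geq_minl.
  by rewrite leq_min => /andP[_ /window_lt/GE].
have nn' : (n <= 4 * B * n')%N by rewrite /n' /minn; case: ltnP; nia.
apply: leq_trans nn' _; apply: (@leq_trans (4 * B * (2 * C * hits E n))); last lia.
rewrite leq_mul2l; apply/orP; right; apply: leq_trans h1 _.
by rewrite leq_mul2l h2 orbT.
Qed.
End nested_returns.

(** [j.+1] has 2-adic valuation [c] exactly when it is congruent to [2 ^ c] modulo
[2 ^ c.+1]. *)
Lemma ruler_recurrence c : exists M, forall k,
  exists2 j, (k <= j <= k + M)%N & logn 2 j.+1 = c.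
Proof.
exists (2 ^ c.+2)%N => k; pose u := (k %/ 2 ^ c.+1).+1.
have e0 : (0 < 2 ^ c)%N by rewrite expn_gt0.
have u1 : (k < u * 2 ^ c.+1)%N by rewrite ltn_ceil// expn_gt0.
have u2 : (u.-1 * 2 ^ c.+1 <= k)%N by exact: leq_trunc_div.
exists ((u.*2.+1) * 2 ^ c).-1.
  by move: u1 u2 e0; rewrite !expnS /=; move: (2 ^ c)%N => x; rewrite /u/=; nia.
rewrite prednK ?muln_gt0// lognM// pfactorK//.
by rewrite logn_coprime ?add0n// coprime2n/= odd_double.
Qed.

Lemma lower_density_gt0 (R : realType) (E : set nat) (c n0 : nat) :
  (forall n, (n0 <= n)%N -> (n <= c * hits (fun k => k \in E) n)%N) ->
  (0 < lower_density R E)%E.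
Proof.
move=> Ec; have c0 : (0 < c)%N.
  by have := Ec n0.+1 (leqnSn _); case: (c) => //; rewrite mul0n.
have h : (0 < ((c%:R)^-1 : R)%:E)%E by rewrite lte_fin invr_gt0 ltr0n.
apply: lt_le_trans h _; rewrite /lower_density limn_einf_lim.
apply: lime_ge; first exact: is_cvg_einfs.
exists n0 => // m /= nm; apply/ereal_infP => _ [k /= mk <-].
rewrite lee_fin ler_pdivlMr ?ltr0n// mulrC ler_pdivrMr ?ltr0n//.
rewrite mulrC -natrM ler_nat.
have -> : #|[pred i : 'I_k.+1 | (i : nat) \in E]| = hits (fun i => i \in E) k.+1.
  by rewrite /hits -val_enum_ord count_map cardE -size_filter enumT.
by apply: Ec; rewrite (leq_trans nm)// (leq_trans mk).
Qed.

(** * Iterates of a linear map *)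

Section linear_iterates.
Context (K : nzRingType) (V : lmodType K) (T : {linear V -> V}).

Lemma iter_linear m (a : K) u v :
  iter m T (a *: u + v) = a *: iter m T u + iter m T v.
Proof. by elim: m => //= m ->; rewrite linearP. Qed.

Lemma iter_linearD m u v : iter m T (u + v) = iter m T u + iter m T v.
Proof. by rewrite -[u in LHS]scale1r iter_linear scale1r. Qed.

Lemma iter_linear0 m : iter m T 0 = 0.
Proof. by elim: m => //= m ->; rewrite linear0. Qed.

Lemma iter_linearZ m (a : K) u : iter m T (a *: u) = a *: iter m T u.
Proof. by rewrite -[a *: u in LHS]addr0 iter_linear iter_linear0 addr0. Qed.

Lemma iter_linearB m u v : iter m T (u - v) = iter m T u - iter m T v.
Proof. by rewrite iter_linearD -scaleN1r iter_linearZ scaleN1r. Qed.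

Lemma iter_linear_sum m (I : Type) (r : seq I) (P : pred I) (F : I -> V) :
  iter m T (\sum_(i <- r | P i) F i) = \sum_(i <- r | P i) iter m T (F i).
Proof.
by elim/big_ind2: _ => [|x a y b <- <-|//]; rewrite ?iter_linear0 ?iter_linearD.
Qed.

Lemma iter_fix k d (x : V) : iter d T x = x -> iter (k * d) T x = x.
Proof. by move=> dx; elim: k => // k IH; rewrite mulSn iterD IH. Qed.

End linear_iterates.

(** * A criterion for common frequent hypercyclicity *)

(** Besides continuity and the periodicity of finitely supported vectors, the operators
enter through [stage]: one may add to [y] a block [z] living beyond any prescribed
coordinate, whose orbits under the operators of index at most [J] are small for a
proportion [1 / B] of the duration [D], and which makes the orbit of [y + z] under the
single operator [T s] follow the orbit of [a] for as long, starting at time [D]. *)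
Section criterion.
Context (R : realType) (p : R) (p1 : 1 <= p).
Variables (T : nat -> {linear lp p1 -> lp p1}) (B : nat).
Hypothesis Tc : forall s, continuous (T s).
Hypothesis B1 : (1 < B)%N.
Hypothesis Tper : forall s n (a : lp p1), supp_lt n a ->
  exists2 q, (0 < q)%N & iter q (T s) a = a.
Hypothesis stage : forall (y a : lp p1) (H s J D0 : nat) (d : R), 0 < d ->
  supp_lt H y -> supp_lt H a -> exists (D : nat) (z : lp p1),
  [/\ (D0 < D)%N, forall i, (i < H)%N -> z i = 0 & exists n, supp_lt n z] /\
  [/\ forall t m, (t <= J)%N -> (B * m <= D)%N -> lpn (iter m (T t) z) <= d,
      forall i, (B * i <= D)%N ->
        lpn (iter (D + i) (T s) (y + z) - iter i (T s) a) <= d &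
      forall t, iter (2 * D) (T t) (y + z) = y + z].

(** Each stage loses a constant factor of density for the tasks that it does not serve,
so a task recurring with unbounded gaps could lose all its density.  Along the 2-adic
valuation every code recurs with bounded gaps. *)
Definition task (j : nat) : nat * seq (rat * rat) :=
  odflt (0%N, [::]) (unpickle (logn 2 j.+1)).

Lemma task_recurrence c : exists M, forall k,
  exists2 j, (k <= j <= k + M)%N & task j = c.
Proof.
have [M MP] := ruler_recurrence (pickle c); exists M => k.
by have [j jk jc] := MP k; exists j => //; rewrite /task jc pickleK.
Qed.

Let eps (j : nat) : R := 2^-1 ^+ j.

Lemma epsS j : eps j = 2 * eps j.+1.
Proof. by rewrite /eps exprS mulrA divff ?mul1r ?pnatr_eq0. Qed.

Lemma eps_gt0 j : 0 < eps j.
Proof. by rewrite exprn_gt0 ?invr_gt0. Qed.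

Lemma eps_small (e M : R) : 0 < e -> exists J, forall j, (J <= j)%N -> M * eps j <= e.
Proof.
move=> e0; exists (Num.bound (`|M| / e)) => j Jj.
have h : `|M| / e < j%:R.
  apply: lt_le_trans (archi_boundP _) _; last by rewrite ler_nat.
  by rewrite divr_ge0// ltW.
apply: (@le_trans _ _ (`|M| * eps j)).
  by rewrite ler_wpM2r ?(ltW (eps_gt0 j))// ler_norm.
rewrite /eps exprVn ler_pdivrMr ?exprn_gt0//.
move: h; rewrite ltr_pdivrMr// => /ltW/le_trans; apply.
rewrite mulrC ler_wpM2l ?(ltW e0)// -natrX ler_nat; exact/ltnW/ltn_expl.
Qed.

(** The sequence of blocks produced by the recursion, with the properties that survive
once the supports of the partial sums are forgotten. *)
Record stages := Stages {
  blk : nat -> lp p1;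
  dur : nat -> nat;
  blk_tail : forall j i, (i < j)%N -> blk j i = 0;
  dur_gt0 : forall j, (0 < dur j)%N;
  dur_grow : forall j, (4 * B * dur j <= dur j.+1)%N;
  blk_small : forall j t m, (t <= j)%N -> (B * m <= dur j)%N ->
    lpn (iter m (T t) (blk j)) <= eps j;
  blk_hit : forall j i, (B * i <= dur j)%N ->
    lpn (iter (dur j + i) (T (task j).1) (\sum_(k < j.+1) blk k)
         - iter i (T (task j).1) (rat_lp p1 (task j).2)) <= eps j;
  blk_per : forall j t,
    iter (2 * dur j) (T t) (\sum_(k < j.+1) blk k) = \sum_(k < j.+1) blk k }.

(** Dependent choice: the state carries the partial sum, a bound for its support, which
the next block has to avoid, and the last duration, which the next one has to
dominate by the factor [4 * B]. *)
Lemma exists_stages : inhabited stages.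
Proof.
have step (u : nat * (lp p1 * nat * nat)) : exists r : lp p1 * nat * nat,
    let: (j, (y, H, D0)) := u in let: (z, H', D) := r in
    supp_lt H y -> [/\ (H < H')%N, supp_lt H' (y + z),
      (4 * B * D0 < D)%N & forall i, (i < H)%N -> z i = 0] /\
    [/\ forall t m, (t <= j)%N -> (B * m <= D)%N -> lpn (iter m (T t) z) <= eps j,
      forall i, (B * i <= D)%N -> lpn (iter (D + i) (T (task j).1) (y + z)
           - iter i (T (task j).1) (rat_lp p1 (task j).2)) <= eps j &
      forall t, iter (2 * D) (T t) (y + z) = y + z].
  case: u => j [[y H] D0].
  have [yH|nyH] := pselect (supp_lt H y); last by exists (0, 0%N, 0%N).
  pose H1 := maxn H (size (task j).2).
  have yH1 : supp_lt H1 y by apply: supp_ltW yH; rewrite leq_maxl.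
  have aH1 : supp_lt H1 (rat_lp p1 (task j).2).
    by apply: supp_ltW (@rat_lp_supp _ _ _ _); rewrite leq_maxr.
  have [D [z [[DD zH1 [n zn]] [z1 z2 z3]]]] :=
    stage (task j).1 j (4 * B * D0) (eps_gt0 j) yH1 aH1.
  exists (z, maxn H.+1 n, D) => _; split; split=> //.
  - by rewrite leq_maxl.
  - apply: supp_ltD; last by apply: supp_ltW zn; rewrite leq_maxr.
    by apply: supp_ltW yH; rewrite (leq_trans (leqnSn H))// leq_maxl.
  - by move=> i iH; apply: zH1; rewrite (leq_trans iH)// leq_maxl.
have [F FP] := choice step.
pose st := fix st j : lp p1 * nat * nat :=
  if j is j'.+1 then ((st j').1.1 + (F (j', st j')).1.1, (F (j', st j')).1.2,
                      (F (j', st j')).2)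
  else (0, 0%N, 1%N).
pose z j := (F (j, st j)).1.1; pose D j := (F (j, st j)).2.
have stS j : st j.+1 = ((st j).1.1 + z j, (F (j, st j)).1.2, D j) by [].
have stsum j : (st j).1.1 = \sum_(k < j) z k.
  elim: j => [|j IH]; first by rewrite big_ord0.
  by rewrite stS big_ord_recr /= IH.
have inv j : supp_lt (st j).1.2 (st j).1.1 /\ (j <= (st j).1.2)%N.
  elim: j => [|j [IH1 IH2]]; first by split.
  have := FP (j, st j); rewrite stS /z /D /=.
  case E : (st j) IH1 IH2 => [[y H] D0] /= IH1 IH2.
  case: (F _) => [[z' H'] D'] /= /(_ IH1) [[h1 h2 _ _] _]; split=> //.
  exact: leq_ltn_trans IH2 h1.
have P j : [/\ (4 * B * (st j).2 < D j)%N & forall i, (i < j)%N -> z j i = 0] /\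
    [/\ forall t m, (t <= j)%N -> (B * m <= D j)%N -> lpn (iter m (T t) (z j)) <= eps j,
      forall i, (B * i <= D j)%N ->
        lpn (iter (D j + i) (T (task j).1) (\sum_(k < j.+1) z k)
           - iter i (T (task j).1) (rat_lp p1 (task j).2)) <= eps j &
      forall t, iter (2 * D j) (T t) (\sum_(k < j.+1) z k) = \sum_(k < j.+1) z k].
  have := FP (j, st j); have [] := inv j; rewrite big_ord_recr/= -stsum /z /D.
  case E : (st j) => [[y H] D0] /= IH1 IH2.
  case: (F _) => [[z' H'] D'] /= /(_ IH1) [[_ h2 h3 h4] h5]; split=> //; split=> // i ij.
  by apply: h4; exact: leq_trans ij IH2.
constructor; apply: (@Stages z D).
- by move=> j; have [[]] := P j.
- by move=> j; have [[+ _] _] := P j; exact: leq_ltn_trans.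
- by move=> j; have [[+ _] _] := P j.+1; rewrite stS => /ltnW.
- by move=> j; have [_ []] := P j.
- by move=> j; have [_ []] := P j.
- by move=> j; have [_ []] := P j.
Qed.

Section limit_vector.
Variable S : stages.
Variable x : lp p1.
Hypothesis xS : forall J, lpn (x - \sum_(j < J) blk S j) <= 2 * eps J.

Lemma dur_mono i j : (i <= j)%N -> (dur S i <= dur S j)%N.
Proof.
elim: j => [|j IH]; first by rewrite leqn0 => /eqP ->.
rewrite leq_eqVlt => /predU1P[->//|]; rewrite ltnS => /IH ij.
by apply: leq_trans ij _; have := dur_grow S j; nia.
Qed.

(** Boundedness of [T t] is used for a fixed number [m] of steps only, and so only to
discard a remainder that is made arbitrarily small; the bound comes from the blocks
themselves. *)
Lemma tail_iterate_small j t m : (t <= j.+1)%N -> (B * m <= dur S j.+1)%N ->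
  lpn (iter m (T t) (x - \sum_(k < j.+1) blk S k)) <= eps j.
Proof.
move=> tj mj; have [M M0 TM] := continuous_lpn_bound (@Tc t).
have itM (u : lp p1) : lpn (iter m (T t) u) <= M ^+ m * lpn u.
  elim: (m) => [|k IH]; first by rewrite expr0 mul1r.
  rewrite iterS exprS -mulrA; apply: le_trans (TM _) _.
  by rewrite ler_wpM2l.
apply/ler_addgt0Pr => e e0.
have [J JP] := eps_small (M ^+ m * 2) e0.
pose K := (j.+1 + J)%N.
have fin n : lpn (iter m (T t) (\sum_(k < j.+1 + n) blk S k - \sum_(k < j.+1) blk S k))
    <= eps j - 2 * eps (j.+1 + n).
  elim: n => [|n IH]; first by rewrite addn0 !subrr iter_linear0 lpn0 -epsS subrr.
  rewrite addnS big_ord_recr/= addrAC iter_linearD.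
  apply: le_trans (ler_lpnD _ _) _.
  have h : lpn (iter m (T t) (blk S (j.+1 + n))) <= eps (j.+1 + n).
    apply: blk_small; first by rewrite (leq_trans tj)// leq_addr.
    by apply: leq_trans mj (dur_mono _); rewrite leq_addr.
  apply: le_trans (lerD IH h) _.
  by rewrite (epsS (j.+1 + n)) -addnS; lra.
rewrite -(subrK (\sum_(k < K) blk S k) x) -addrA iter_linearD [X in lpn X]addrC.
apply: le_trans (ler_lpnD _ _) _; apply: lerD.
  by apply: le_trans (fin J) _; rewrite lerBlDr lerDl mulr_ge0// ltW// eps_gt0.
apply: le_trans (itM _) _; apply: (le_trans _ (JP K (leq_addl _ _))).
by rewrite -mulrA ler_wpM2l// exprn_ge0.
Qed.

Lemma limit_vector_hits s (c : seq (rat * rat)) (e : R) : 0 < e ->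
  exists (C n0 : nat), forall n, (n0 <= n)%N ->
    (n <= C * hits (fun m => (lpn (iter m (T s) x - rat_lp p1 c) < e)%R) n)%N.
Proof.
move=> e0; pose a := rat_lp p1 c; pose y j := \sum_(k < j.+1) blk S k.
have [q q0 qa] := Tper s (@rat_lp_supp _ _ p1 c).
(* The tolerance grows with j: it leaves room for the perturbations by all later
   blocks, whose orbits add up to at most eps j during the window after stage j. *)
pose G j m := (s <= j)%N && (lpn (iter m (T s) (y j) - a) <= e - 2 * eps j).
pose good j := [&& (s <= j)%N, 3 * eps j <= e & task j == (s, c)].
have [J JP] := eps_small 3 e0.
have [M MP] := task_recurrence (s, c).
apply: (@nested_returns_density (dur S) B (ltnW B1) _ _ G _ _ _ q M good q0 _ _ (maxn s J)) => //.
- exact: dur_gt0.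
- exact: dur_grow.
- by move=> j i; rewrite /G iterD blk_per.
- move=> j i ij /andP[sj Gj]; rewrite /G (leq_trans sj (leqnSn j))/=.
  rewrite {1}/y big_ord_recr/= -/(y j) iter_linearD addrAC.
  apply: le_trans (ler_lpnD _ _) _.
  have h := blk_small (leq_trans sj (leqnSn j)) ij.
  apply: le_trans (lerD Gj h) _; have := epsS j; have := eps_gt0 j.+1; lra.
- move=> j i ij /andP[sj Gj].
  rewrite -(subrK (y j) x) iter_linearD -addrA.
  apply: le_lt_trans (ler_lpnD _ _) _.
  have h := tail_iterate_small (leq_trans sj (leqnSn j)) ij.
  apply: le_lt_trans (lerD h Gj) _; have := eps_gt0 j; lra.
- move=> j i /and3P[sj ej /eqP tj] ij; rewrite /G sj/=.
  have := blk_hit ij; rewrite tj/= [in X in _ - X]mulnC iter_fix// => h.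
  by apply: le_trans h _; lra.
- move=> k; rewrite geq_max => /andP[sk Jk].
  have [j /andP[kj jk] tj] := MP k; exists j; first by rewrite kj.
  by rewrite /good (leq_trans sk kj) JP ?(leq_trans Jk)//= tj eqxx.
Qed.

Lemma limit_vector_FHC s : FHC R (T s) x.
Proof.
move=> U oU [u Uu]; have [e e0 eU] := open_lpn_ball oU Uu.
have e2 : 0 < e / 2 by rewrite divr_gt0.
have [c uc] := rat_lp_dense u e2.
have [C [n0 Cn0]] := limit_vector_hits s c e2.
apply: (@lower_density_gt0 _ _ C n0) => n /Cn0/leq_trans; apply.
rewrite leq_mul2l; apply/orP; right; apply: leq_hits => // i _ h.
rewrite inE /=; apply: eU; apply: le_lt_trans (ler_lpn_dist (rat_lp p1 c) _ _) _.
by rewrite [e]splitr ltrD// lpnBC.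
Qed.
End limit_vector.

Lemma common_FHC : exists x, forall s, FHC R (T s) x.
Proof.
have [S] := exists_stages.
have [||x xP] := @lp_block_series _ _ p1 (blk S).
- exact: blk_tail.
- by move=> j; apply: (@blk_small S j 0%N 0%N) => //; rewrite muln0.
by exists x => s; apply: limit_vector_FHC xP s.
Qed.
End criterion.

(** * Dynamics of operators of C-type *)

Lemma block_of_index (b : nat -> nat) : b 0%N = 0%N -> {homo b : m n / (m < n)%N} ->
  forall h, exists2 l, (l <= h)%N & (b l <= h < b l.+1)%N.
Proof.
move=> b0 bI h; have bj j : (j <= b j)%N.
  by elim: j => // j IH; apply: leq_ltn_trans IH (bI _ _ (ltnSn j)).
have ex : exists j, (b j <= h)%N by exists 0%N; rewrite b0.
have ub j : (b j <= h)%N -> (j <= h)%N by apply: leq_trans.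
case: (ex_maxnP ex ub) => l lh lmax; exists l; first exact: ub.
by rewrite lh ltnNge; apply/negP => /lmax; rewrite ltnn.
Qed.

Section C_type_dynamics.
Context (R : realType).
Context (v w : nat -> R[i]) (phi b : nat -> nat).
Hypothesis Cd : C_type_data v w phi b.

Lemma C_type_w_neq0 n : (0 < n)%N -> w n != 0.
Proof.
move=> n0; apply/eqP => wn0; have := C_type_w_inf Cd.
rewrite ltNge => /negP; apply; apply: ereal_inf_lbound.
by exists n => //=; rewrite wn0 normc0.
Qed.

Lemma C_type_prod_neq0 m n : \prod_(m.+1 <= j < n) w j != 0.
Proof.
rewrite prodf_seq_neq0; apply/allP => j; rewrite mem_index_iota => /andP[mj _].
by apply: C_type_w_neq0; exact: leq_trans mj.
Qed.

Lemma C_type_b_leq m n : (m <= n)%N -> (b m <= b n)%N.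
Proof.
rewrite leq_eqVlt => /predU1P[->//|/(C_type_b_incr Cd)]; exact: ltnW.
Qed.

Lemma C_type_b_ge n : (n <= b n)%N.
Proof. by elim: n => // n IH; apply: leq_ltn_trans IH (C_type_b_incr Cd (ltnSn n)). Qed.

Context (p : R) (p1 : 1 <= p).

(** Dividing [e_(b n + m)] by what the orbit still has to pick up before the end of
the block makes the iteration a plain translation inside the block. *)
Definition pulse n m : lp p1 :=
  (v n * \prod_((b n + m).+1 <= j < b n.+1) w j)^-1 *: lp_unit p1 (b n + m).

Lemma lpn_pulse n m : lpn (pulse n m) =
  (normc (v n) * normc (\prod_((b n + m).+1 <= j < b n.+1) w j))^-1.
Proof. by rewrite lpnZ lpn_unit mulr1 normcV normcM. Qed.

(** The next lemmas follow an operator with weights [w'] on a pulse normalised for the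
weights [w]; both families share [phi] and [b]. *)
Section operator.
Variables (w' v' : nat -> R[i]) (T : {linear lp p1 -> lp p1}).
Hypothesis CT : is_C_type_operator v' w' phi b T.

Lemma iter_unit n k m : (b n <= k)%N -> (k + m < b n.+1)%N ->
  iter m T (lp_unit p1 k) =
  \prod_(k.+1 <= j < (k + m).+1) w' j *: lp_unit p1 (k + m).
Proof.
move=> nk; elim: m => [|m IH] km.
  by rewrite addn0 big_geq// scale1r.
rewrite iterS IH ?linearZ/=; last by apply: ltn_trans km; rewrite addnS.
rewrite (C_type_shift CT (n := n)); last by lia.
by rewrite scalerA addnS [in RHS]big_nat_recr//= ltnS leq_addr.
Qed.

Lemma iter_unit_end n k : (0 < n)%N -> (b n <= k < b n.+1)%N ->
  iter (b n.+1 - k) T (lp_unit p1 k) = \prod_(k.+1 <= j < b n.+1) w' j *: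
    (v' n *: lp_unit p1 (b (phi n))
     - (\prod_((b n).+1 <= j < b n.+1) w' j)^-1 *: lp_unit p1 (b n)).
Proof.
move=> n0 /andP[nk kn].
have -> : (b n.+1 - k = (b n.+1 - k).-1.+1)%N by lia.
rewrite iterS (iter_unit nk); last lia.
have -> : (k + (b n.+1 - k).-1 = (b n.+1).-1)%N by lia.
rewrite linearZ/= (C_type_last CT n0) prednK//; lia.
Qed.

(** Only the quotient of the two weight products over the travelled stretch appears:
this is why bounded quotients suffice to control all operators at once. *)
Lemma iter_pulse n r m : (r + m < b n.+1 - b n)%N ->
  iter m T (pulse n r) =
  (\prod_((b n + r).+1 <= j < (b n + r + m).+1) w' j /
   \prod_((b n + r).+1 <= j < (b n + r + m).+1) w j) *: pulse n (r + m).
Proof.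
move=> rm; rewrite /pulse iter_linearZ (@iter_unit n); [|lia..].
rewrite !scalerA -addnA; congr (_ *: _).
rewrite [in LHS](@big_cat_nat _ _ _ (b n + (r + m)).+1)/=; [|lia..].
have := C_type_prod_neq0 (b n + r) (b n + (r + m)).+1.
move: (\prod_(_ <= j < (b n + (r + m)).+1) w j) => W W0.
rewrite !invfM mulrC -!mulrA; congr (_ * _).
by rewrite mulrCA.
Qed.
End operator.

Section own_operator.
Variable T : {linear lp p1 -> lp p1}.
Hypothesis CT : is_C_type_operator v w phi b T.

(** On leaving the block, [T (pulse n (L - 1)) = e_(b (phi n)) - pulse n 0], [L] being
the length of the block; the two terms then evolve separately. *)
Lemma iter_pulse_end n r j : (0 < n)%N ->
  (r < b n.+1 - b n)%N -> (j < b n.+1 - b n)%N ->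
  iter (b n.+1 - b n - r + j) T (pulse n r) =
  iter j T (lp_unit p1 (b (phi n))) - pulse n j.
Proof.
move=> n0 rn jn; have vn := C_type_v_neq0 Cd n0.
have bn : (b n < b n.+1)%N by apply: C_type_b_incr Cd _ _ _.
have e0 : iter (b n.+1 - b n - r) T (pulse n r) =
    lp_unit p1 (b (phi n)) - pulse n 0.
  rewrite /pulse iter_linearZ -subnDA (iter_unit_end CT n0); last lia.
  have := C_type_prod_neq0 (b n + r) (b n.+1).
  have := C_type_prod_neq0 (b n) (b n.+1).
  rewrite addn0 => W0 P0.
  rewrite scalerA invfM -mulrA mulVf// mulr1 scalerBr !scalerA mulVf// scale1r.
  by rewrite invfM.
rewrite addnC iterD e0 iter_linearB; congr (_ - _).
rewrite (iter_pulse CT) ?add0n// divff ?scale1r//.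
exact: C_type_prod_neq0.
Qed.

(** After one turn, [e_(b n)] becomes [c *: e_(b (phi n)) - e_(b n)].  The length of the
block is a period of [e_(b (phi n))] by induction, so the second turn cancels the
first term and restores [e_(b n)]. *)
Lemma iter_unit_period n : iter (2 * (b n.+1 - b n)) T (lp_unit p1 (b n))
  = lp_unit p1 (b n).
Proof.
elim/ltn_ind: n => n IH; rewrite mul2n -addnn iterD.
have bn : (b n < b n.+1)%N by apply: C_type_b_incr Cd _ _ _.
have W0 := C_type_prod_neq0 (b n) (b n.+1).
case: n => [|n] in IH bn W0 *.
  suff h : iter (b 1%N - b 0%N) T (lp_unit p1 (b 0%N)) = - lp_unit p1 (b 0%N).
    by rewrite h -scaleN1r iter_linearZ h scaleN1r opprK.
  have -> : (b 1%N - b 0%N = (b 1%N - b 0%N).-1.+1)%N by lia.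
  rewrite iterS (iter_unit CT (leqnn _)); last lia.
  have -> : (b 0%N + (b 1%N - b 0%N).-1 = (b 1%N).-1)%N by lia.
  rewrite linearZ/= (C_type_last0 CT) prednK; last lia.
  by rewrite scalerN scalerA divff// scale1r (C_type_b0 Cd).
have h : iter (b n.+2 - b n.+1) T (lp_unit p1 (b n.+1)) =
    (\prod_((b n.+1).+1 <= j < b n.+2) w j * v n.+1) *: lp_unit p1 (b (phi n.+1))
    - lp_unit p1 (b n.+1).
  by rewrite (iter_unit_end CT)// ?leqnn// scalerBr !scalerA divff// scale1r.
have hphi : iter (b n.+2 - b n.+1) T (lp_unit p1 (b (phi n.+1))) =
    lp_unit p1 (b (phi n.+1)).
  have /dvdnP[k ->] := C_type_b_dvd Cd (ltn0Sn n).
  by rewrite iter_fix// IH// (C_type_phi_lt Cd).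
by rewrite {1}h iter_linearB iter_linearZ hphi h opprB addrCA subrr addr0.
Qed.

Lemma iter_unit_fix d n k : (b n <= k < b n.+1)%N ->
  (2 * (b n.+1 - b n) %| d)%N -> iter d T (lp_unit p1 k) = lp_unit p1 k.
Proof.
move=> /andP[nk kn] /dvdnP[c ->]; apply: iter_fix.
have := @iter_unit _ _ _ CT n (b n) (k - b n)%N (leqnn _).
rewrite subnKC// => /(_ kn) ek.
have P0 := C_type_prod_neq0 (b n) k.+1.
have -> : lp_unit p1 k = (\prod_((b n).+1 <= j < k.+1) w j)^-1 *:
    iter (k - b n) T (lp_unit p1 (b n)).
  by rewrite ek scalerA mulVf// scale1r.
by rewrite iter_linearZ -iterD addnC iterD iter_unit_period.
Qed.

Lemma iter_supp_fix d N (x : lp p1) : supp_lt (b N) x ->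
  (forall l, (l < N)%N -> (2 * (b l.+1 - b l) %| d)%N) -> iter d T x = x.
Proof.
move=> xN dN; rewrite (supp_lt_sum xN) iter_linear_sum; apply: eq_bigr => h _.
rewrite iter_linearZ.
have [l lh lb] := block_of_index (C_type_b0 Cd) (C_type_b_incr Cd) h.
rewrite (iter_unit_fix lb)//; apply: dN.
rewrite ltnNge; apply/negP => Nl; have := C_type_b_leq Nl.
have := ltn_ord h; move: lb => /andP[lb _]; lia.
Qed.

(** A pulse only produces the first vector of the block [phi n]; to reach [e_h] it
starts [h - b (phi n)] positions further inside its own block, so that it arrives
that much earlier. *)
Lemma iter_pulse_simulates n h i : (0 < n)%N ->
  (b (phi n) <= h < b (phi n).+1)%N ->
  (h - b (phi n) + i < b n.+1 - b n)%N ->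
  iter (b n.+1 - b n + i) T
    ((\prod_((b (phi n)).+1 <= j < h.+1) w j)^-1 *: pulse n (h - b (phi n)))
  - iter i T (lp_unit p1 h) =
  - ((\prod_((b (phi n)).+1 <= j < h.+1) w j)^-1 *: pulse n (h - b (phi n) + i)).
Proof.
move=> n0 /andP[lh hl]; set r := (h - b (phi n))%N => ri.
have -> : (b n.+1 - b n + i = b n.+1 - b n - r + (r + i))%N by lia.
rewrite iter_linearZ iter_pulse_end//; last lia.
rewrite addnC iterD (iter_unit CT (leqnn _)) ?subnKC// iter_linearZ.
rewrite scalerBr scalerA mulVf ?C_type_prod_neq0// scale1r.
by rewrite [(i + r)%N]addnC addrAC subrr add0r.
Qed.
End own_operator.
End C_type_dynamics.

(** * One stage of the construction *)

Section C_plus.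
Context (R : realType).
Context (v w : nat -> R[i]) (phi b Delta : nat -> nat).
Context (vk : nat -> R[i]) (wk : nat -> nat -> R[i]).
Hypothesis Cp : C_plus_type_data v w phi b Delta vk wk.
Let Cd := C_plus_C_type Cp.

Lemma C_plus_level k l : (0 < k)%N -> (l < 2 ^ k.-1)%N ->
  (2 ^ k.-1 <= 2 ^ k.-1 + l < 2 ^ k)%N.
Proof.
case: k => // k _ /= lk; rewrite leq_addr/= expnS mul2n -addnn.
by rewrite ltn_add2l.
Qed.

(** [l] is [phi n] for [n = 2 ^ k.-1 + l], a block of length [Delta k]. *)
Lemma C_plus_Delta_dvd k l : (0 < k)%N -> (l < 2 ^ k.-1)%N ->
  (2 * (b l.+1 - b l) %| Delta k)%N.
Proof.
move=> k0 lk; have nk := C_plus_level k0 lk.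
have n0 : (0 < 2 ^ k.-1 + l)%N by rewrite addn_gt0 expn_gt0.
have := C_type_b_dvd Cd n0.
by rewrite (C_plus_phi Cp k0 nk) addKn (C_plus_b Cp k0 nk).
Qed.

Lemma C_plus_2Delta_dvd k l : (0 < k)%N -> (l < 2 ^ k)%N ->
  (2 * (b l.+1 - b l) %| 2 * Delta k)%N.
Proof.
move=> k0 lk; case: (ltnP l (2 ^ k.-1)) => lk'.
  by apply: dvdn_mull; exact: C_plus_Delta_dvd.
by rewrite (@C_plus_b _ _ _ _ _ _ _ _ Cp k l k0) ?lk'.
Qed.

Lemma C_plus_Delta_gt0 k : (0 < k)%N -> (0 < Delta k)%N.
Proof.
move=> k0; rewrite -(@C_plus_b _ _ _ _ _ _ _ _ Cp k (2 ^ k.-1)%N k0).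
  by rewrite subn_gt0 (C_type_b_incr Cd).
by rewrite leqnn ltn_exp2l//; lia.
Qed.

Lemma C_plus_Delta_ge k : (0 < k)%N -> (k <= Delta k)%N.
Proof.
elim: k => // k IH _; case: (posnP k) => [->|k0]; first exact: C_plus_Delta_gt0.
have kk : (2 ^ k.-1 < 2 ^ k)%N by rewrite ltn_exp2l//; lia.
have := @C_plus_Delta_dvd k.+1 _ isT kk.
rewrite (@C_plus_b _ _ _ _ _ _ _ _ Cp k _ k0) ?leqnn//.
move=> /(dvdn_leq (C_plus_Delta_gt0 (ltn0Sn k))).
by have := IH k0; have := C_plus_Delta_gt0 k0; lia.
Qed.

Lemma normc_prod (I : Type) (r : seq I) (P : pred I) (F : I -> R[i]) :
  normc (\prod_(i <- r | P i) F i) = \prod_(i <- r | P i) normc (F i).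
Proof. exact: (big_morph _ (@normcM R) (@normc1 R)). Qed.

Lemma C_plus_pulse_small (p : R) (p1 : 1 <= p) k n m (C : R) : (0 < k)%N ->
  (2 ^ k.-1 <= n < 2 ^ k)%N -> 0 < C ->
  C < normc (vk k) * \prod_(m.+1 <= i < Delta k) normc (wk k i) ->
  lpn (pulse v w b p1 n m) <= C^-1.
Proof.
move=> k0 nk C0 Clt; rewrite lpn_pulse normc_prod (C_plus_v Cp k0 nk).
have bn : (b n < b n.+1)%N by apply: C_type_b_incr Cd _ _ _.
have -> : \prod_((b n + m).+1 <= j < b n.+1) normc (w j) =
    \prod_(m.+1 <= i < Delta k) normc (wk k i).
  rewrite -addnS addnC big_addn (C_plus_b Cp k0 nk).
  apply: eq_big_nat => i /andP[mi iD]; rewrite addnC (C_plus_w Cp k0 nk)//.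
  by rewrite iD (leq_trans _ mi).
by rewrite lef_pV2 ?posrE ?(lt_trans C0 Clt)// ltW.
Qed.

End C_plus.

Section stage.
Context (R : realType) (p : R) (p1 : 1 <= p).
Context (v w : nat -> nat -> R[i]) (phi b : nat -> nat).
Context (Delta : nat -> nat) (vk : nat -> nat -> R[i]).
Context (wk : nat -> nat -> nat -> R[i]).
Context (T : nat -> {linear lp p1 -> lp p1}).
Hypothesis Cplus : forall s,
  C_plus_type_data (v s) (w s) phi b Delta (vk s) (wk s).
Hypothesis T_C_type : forall s, is_C_type_operator (v s) (w s) phi b (T s).
Context (alpha : R).
Hypothesis vw_large : forall s (C : R), 1 <= C -> forall k0, (1 <= k0)%N ->
  exists2 k, (k0 <= k)%N & forall n : nat, n%:R <= alpha * (Delta k)%:R ->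
    C < normc (vk s k) * \prod_(n.+1 <= i < Delta k) normc (wk s k i).
Hypothesis w_ratio : forall s t, exists2 K : R, 0 < K &
  forall r rho, (1 <= rho <= r)%N ->
    normc ((\prod_(rho <= j < r.+1) w t j) /
           (\prod_(rho <= j < r.+1) w s j)) <= K.
Context (B : nat).
(* If r and m are at most D / B, then r + m is at most both alpha * D and 2 * D / 3. *)
Hypothesis B3 : (2 < B)%N.
Hypothesis B_alpha : 2 <= alpha * B%:R.

Let Cd s := C_plus_C_type (Cplus s).

Lemma w_ratio_uniform s J : exists2 K : R, 1 <= K & forall t m n, (t <= J)%N ->
  normc ((\prod_(m.+1 <= j < n.+1) w t j) /
         (\prod_(m.+1 <= j < n.+1) w s j)) <= K.
Proof.
have [K K0 KP] : exists2 K : nat -> R, forall t, 0 < K t & forall t r rho,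
    (1 <= rho <= r)%N -> normc ((\prod_(rho <= j < r.+1) w t j) /
           (\prod_(rho <= j < r.+1) w s j)) <= K t.
  have [K KP] := choice (fun t => let: ex_intro2 K h1 h2 := w_ratio s t in
    ex_intro (fun K => 0 < K /\ _) K (conj h1 h2)).
  by exists K => t; have [] := KP t.
(* The summand 1 takes care of empty products. *)
exists (1 + \sum_(t < J.+1) K t).
  by rewrite lerDl sumr_ge0// => t _; exact/ltW.
move=> t m n; rewrite -ltnS => tJ.
have K1 : 0 <= \sum_(t < J.+1) K t by rewrite sumr_ge0// => i _; exact/ltW.
case: (leqP m.+1 n) => mn; last first.
  by rewrite !big_geq// divr1 normc1 lerDl.
apply: le_trans (KP t n m.+1 _) _; first by rewrite mn.
rewrite (bigD1 (Ordinal tJ))//= addrCA lerDl addr_ge0// sumr_ge0// => i _.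
exact/ltW.
Qed.

Lemma C_plus_supp_period s k N (x : lp p1) : (0 < k)%N ->
  (N <= b (2 ^ k))%N -> supp_lt N x -> iter (2 * Delta k) (T s) x = x.
Proof.
move=> k0 Nk xN; apply: (iter_supp_fix (Cd s) (T_C_type s) (supp_ltW Nk xN)).
by move=> l; exact: (C_plus_2Delta_dvd (Cplus s) k0).
Qed.

(** Each coordinate [h] of [u := a - y] is simulated by one pulse at level [k], placed in
the block [2 ^ k.-1 + l] where [l] is the block of [h].  Beyond the time [Delta k],
which is a period of [y], the orbit of [z] replaces that of [y] by that of [a]. *)
Lemma C_plus_stage (y a : lp p1) (H s J D0 : nat) (d : R) : 0 < d ->
  supp_lt H y -> supp_lt H a -> exists (D : nat) (z : lp p1),
  [/\ (D0 < D)%N, forall i, (i < H)%N -> z i = 0 & exists n, supp_lt n z] /\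
  [/\ forall t m, (t <= J)%N -> (B * m <= D)%N -> lpn (iter m (T t) z) <= d,
      forall i, (B * i <= D)%N ->
        lpn (iter (D + i) (T s) (y + z) - iter i (T s) a) <= d &
      forall t, iter (2 * D) (T t) (y + z) = y + z].
Proof.
move=> d0 yH aH; pose u := a - y.
have uH : supp_lt H u := supp_ltB aH yH.
have [K K1 KP] := w_ratio_uniform s J.
have K0 : 0 < K by apply: lt_le_trans K1.
have [lev levP] : exists lev : nat -> nat, forall h,
    (lev h <= h)%N /\ (b (lev h) <= h < b (lev h).+1)%N.
  suff /choice[f fP] : forall h, exists l, (l <= h)%N /\ (b l <= h < b l.+1)%N.
    by exists f.
  move=> h; have [l l1 l2] :=
    block_of_index (C_type_b0 (Cd s)) (C_type_b_incr (Cd s)) h.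
  by exists l.
pose P h := \prod_((b (lev h)).+1 <= j < h.+1) w s j.
pose A := \sum_(h < H) normc (u h) * normc (P h)^-1.
have A0 : 0 <= A by rewrite sumr_ge0// => h _; rewrite mulr_ge0 ?normc_ge0.
(* All error terms are at most A * K times the norm of a pulse, which is at most
   1 / C. *)
pose C := 1 + A * K / d.
have C1 : 1 <= C by rewrite lerDl divr_ge0 ?mulr_ge0// ltW.
have C0 : 0 < C by apply: lt_le_trans C1.
have AKC : A * K * C^-1 <= d.
  by rewrite ler_pdivrMr// /C mulrDr mulr1 mulrCA divff ?gt_eqF// mulr1 lerDr ltW.
(* The three summands make the duration exceed D0 and B times the offset inside its
   block of any index below H, and put level k beyond the coordinate H. *)
have [k kk0 kC] := vw_large s C1 (k0 := (D0 + B * H + H).+1) isT.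
have k0 : (0 < k)%N by exact: leq_trans kk0.
have Dk : (k <= Delta k)%N := C_plus_Delta_ge (Cplus s) k0.
have kpow : (k.-1 < 2 ^ k.-1)%N by exact: ltn_expl.
have Hb : (H <= b (2 ^ k.-1))%N.
  by apply: leq_trans (C_type_b_ge (Cd s) _); lia.
pose D := Delta k; pose n h := (2 ^ k.-1 + lev h)%N.
have nk h : (h < H)%N -> (2 ^ k.-1 <= n h < 2 ^ k)%N.
  by move=> hH; apply: C_plus_level => //; have [+ _] := levP h; lia.
have n0 h : (0 < n h)%N by rewrite addn_gt0 expn_gt0.
have phin h : (h < H)%N -> phi (n h) = lev h.
  by move=> hH; rewrite (C_plus_phi (Cplus s) k0 (nk h hH)) addKn.
have bn h : (h < H)%N -> (b (n h).+1 - b (n h))%N = D.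
  by move=> hH; rewrite (C_plus_b (Cplus s) k0 (nk h hH)).
pose r h := (h - b (lev h))%N.
have rm h m : (h < H)%N -> (B * m <= D)%N ->
    (r h + m < D)%N /\ (r h + m)%:R <= alpha * D%:R.
  move=> hH mD; have rH : (B * r h <= D)%N.
    have : (B * r h <= B * H)%N.
      by rewrite leq_mul2l; apply/orP; right; rewrite /r; lia.
    by rewrite /D; lia.
  split.
    have D_gt0 : (0 < D)%N by rewrite /D; lia.
    have three x : (B * x <= D)%N -> (3 * x <= D)%N.
      by apply: leq_trans; rewrite leq_mul2r B3 orbT.
    by have := three _ rH; have := three _ mD; lia.
  have Brm : (B * (r h + m))%:R <= (2 * D)%:R :> R by rewrite ler_nat mulnDr; lia.
  have B0 : 0 < B%:R :> R by rewrite ltr0n; lia.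
  rewrite -(ler_pM2l B0) -natrM; apply: le_trans Brm _.
  by rewrite natrM mulrCA mulrA ler_wpM2r// ler0n.
have small h m : (h < H)%N -> (B * m <= D)%N ->
    lpn (pulse (v s) (w s) b p1 (n h) (r h + m)) <= C^-1.
  move=> hH /(rm _ _ hH)[_ /kC].
  exact: (C_plus_pulse_small (Cplus s) p1 k0 (nk h hH) C0).
pose zeta h := (P h)^-1 *: pulse (v s) (w s) b p1 (n h) (r h).
pose z := \sum_(h < H) u h *: zeta h.
have supp_zeta h : (h < H)%N -> forall i, i != (b (n h) + r h)%N -> zeta h i = 0.
  by move=> hH i /negPf ni; rewrite !lp_coordZ lp_coord_unit ni !mulr0.
have bnh h : (h < H)%N -> (H <= b (n h) + r h < b (2 ^ k))%N.
  move=> hH; have /andP[k1 k2] := nk h hH.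
  have := C_type_b_leq (Cd s) k1; have := C_type_b_leq (Cd s) k2.
  have := C_type_b_incr (Cd s) (ltnSn (n h)).
  have [|+ _] := rm h 0%N hH; first by rewrite muln0.
  by rewrite addn0 -(bn h hH); lia.
have zk : supp_lt (b (2 ^ k)) z.
  move=> i ki; rewrite lp_coord_sum big1// => h _.
  rewrite lp_coordZ supp_zeta ?mulr0//; have := bnh h (ltn_ord h); lia.
exists D, z; split; split.
- by rewrite /D; lia.
- move=> i iH; rewrite lp_coord_sum big1// => h _.
  rewrite lp_coordZ supp_zeta ?mulr0//; have := bnh h (ltn_ord h); lia.
- by exists (b (2 ^ k)%N).
- move=> t m tJ mD; rewrite iter_linear_sum.
  apply: le_trans (ler_lpn_sum _ _ _) _; apply: le_trans AKC.
  rewrite /A !mulr_suml; apply: ler_sum => h _.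
  rewrite /zeta 2!iter_linearZ (iter_pulse (Cd s) (T_C_type t)); last first.
    by rewrite bn//; have [] := rm h m (ltn_ord h) mD.
  rewrite 3!lpnZ -!mulrA ler_wpM2l ?normc_ge0// ler_wpM2l ?normc_ge0//.
  apply: ler_pM; rewrite ?normc_ge0 ?lpn_ge0//; first exact: KP.
  exact: small.
- move=> i iD.
  have yD : iter D (T s) y = y.
    apply: (iter_supp_fix (Cd s) (T_C_type s) (supp_ltW Hb yH)) => l.
    exact: (C_plus_Delta_dvd (Cplus s) k0).
  have -> : a = y + \sum_(h < H) u h *: lp_unit p1 h.
    by rewrite -(supp_lt_sum uH) addrC subrK.
  rewrite !iter_linearD addnC iterD yD opprD addrACA subrr add0r.
  rewrite !iter_linear_sum -sumrB.
  apply: le_trans (ler_lpn_sum _ _ _) _.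
  apply: (@le_trans _ _ (A * C^-1)); last first.
    by apply: le_trans AKC; rewrite -mulrA ler_wpM2l// ler_peMl// invr_ge0 ltW.
  rewrite /A mulr_suml; apply: ler_sum => h _; have hH := ltn_ord h.
  rewrite [X in X - _]iter_linearZ [X in _ - X]iter_linearZ -scalerBr.
  rewrite addnC lpnZ -mulrA.
  rewrite ler_wpM2l ?normc_ge0//.
  have := iter_pulse_simulates (Cd s) (T_C_type s) (n := n h) (h := h) (i := i) (n0 h).
  rewrite (phin h hH) (bn h hH) => -> //; last 2 first.
  + by have [] := levP h.
  + by have [] := rm h i hH iD.
  by rewrite lpnN lpnZ ler_wpM2l ?normc_ge0// small.
- move=> t; apply: (@C_plus_supp_period t k (b (2 ^ k)) _ k0 (leqnn _)).
  apply: supp_ltD; last by exact: zk.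
  apply: supp_ltW yH; apply: leq_trans Hb _; apply: (C_type_b_leq (Cd s)).
  by rewrite leq_exp2l//; lia.
Qed.
End stage.

Theorem theorem3p2 (R : realType) (p : R) (p1 : 1 <= p)
  (v w : nat -> nat -> R[i]) (phi b : nat -> nat)
  (Delta : nat -> nat) (vk : nat -> nat -> R[i])
  (wk : nat -> nat -> nat -> R[i])
  (T : nat -> {linear lp p1 -> lp p1})
  (Cplus : forall s, (1 <= s)%N ->
    C_plus_type_data (v s) (w s) phi b Delta (vk s) (wk s))
  (T_C_type : forall s, (1 <= s)%N ->
    is_C_type_operator (v s) (w s) phi b (T s))
  (alpha : R) (alpha_gt0 : 0 < alpha)
  (vw_large : forall s, (1 <= s)%N ->
    forall C : R, 1 <= C -> forall k0, (1 <= k0)%N ->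
    exists2 k, (k0 <= k)%N &
      forall n : nat, n%:R <= alpha * (Delta k)%:R ->
        C < normc (vk s k) * \prod_(n.+1 <= i < Delta k) normc (wk s k i))
  (w_ratio : forall s t, (1 <= s)%N -> (1 <= t)%N ->
    exists2 K : R, 0 < K &
      forall r rho, (1 <= rho <= r)%N ->
        normc ((\prod_(rho <= j < r.+1) w t j) /
               (\prod_(rho <= j < r.+1) w s j)) <= K) :
  \bigcap_(s in [set s | (1 <= s)%N]) FHC R (T s) !=set0.
Proof.
pose B := (Num.bound (2 / alpha)).+3.
have B_alpha : 2 <= alpha * B%:R.
  rewrite mulrC -ler_pdivrMr//; apply: ltW.
  apply: lt_le_trans (archi_boundP _) _; first by rewrite divr_ge0// ltW.
  by rewrite ler_nat /B -addn3 leq_addr.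
have Tc s : continuous (T s.+1) by exact: C_type_bounded (T_C_type _ _).
have Tper s n (a : lp p1) : supp_lt n a ->
    exists2 q, (0 < q)%N & iter q (T s.+1) a = a.
  move=> an; exists (2 * Delta n.+1)%N.
    by rewrite muln_gt0/= (C_plus_Delta_gt0 (Cplus s.+1 isT)).
  apply: (@C_plus_supp_period _ _ _ _ _ _ _ _ _ _ (fun s => T s.+1)
    (fun s => Cplus s.+1 isT) (fun s => T_C_type s.+1 isT) s n.+1 n) => //.
  apply: leq_trans (C_type_b_ge (C_plus_C_type (Cplus s.+1 isT)) _).
  by apply: leq_trans (ltnW (ltn_expl n.+1 (ltnSn 1))); exact: leqnSn.
have stage := @C_plus_stage _ _ _ _ _ _ _ _ _ _ (fun s => T s.+1)
  (fun s => Cplus s.+1 isT) (fun s => T_C_type s.+1 isT) alpha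
  (fun s => vw_large s.+1 isT) (fun s t => w_ratio s.+1 t.+1 isT isT) B isT B_alpha.
have [x xFHC] := common_FHC Tc (isT : (1 < B)%N) Tper stage.
by exists x => -[//|s] _; exact: xFHC.
Qed.
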